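(* Let $\alpha>1$ and let $X,X_1,X_2,\dots$ be independent, identically distributed random variables in a sub-linear expectation space $(\Omega,\mathcal H,\mathbb E)$, with partial sums $S_n=\sum_{k=1}^nX_k$. Suppose that $$\mathbb E\Big\{\exp\big\{(\log^+|X|)^\alpha\big\}\Big\}\le C_{\mathbb V}\Big\{\exp\big\{(\log^+|X|)^\alpha\big\}\Big\}<\infty\quad\text{and}\quad \mathbb E(X)=\mathbb E(-X)=0.$$ Then $$\sum_{n=1}^\infty \exp\{(\log n)^\alpha\}\frac{(\log n)^{\alpha-1}}{n^2}\,\mathbb V\{|S_n|>n\varepsilon\}<\infty\quad\text{for all }\varepsilon>1.$$
   Context: $(\Omega,\mathcal H,\mathbb E)$ is a sub-linear expectation space: $\mathcal H$ is a set of random variables on a measurable space $(\Omega,\mathcal F)$ closed under composition with locally Lipschitz functions $\varphi$ (i.e. $|\varphi(x)-\varphi(y)|\le C(1+|x|^m+|y|^m)|x-y|$), and $\mathbb E:\mathcal H\to[-\infty,\infty]$ is monotone, constant-preserving, positively homogeneous and sub-additive. $\mathbb E$ is assumed regular ($X_n\downarrow0$ pointwise implies $\mathbb E(X_n)\to0$) and countably sub-additive ($0\le X\le\sum_n X_n$, $X_n\ge0$ implies $\mathbb E(X)\le\sum_n\mathbb E(X_n)$). By regularity there is a family $\mathcal P$ of probability measures with $\mathbb E(X)=\sup_{P\in\mathcal P}E_P(X)$; set $\bar{\mathbb E}(X)=\sup_{P\in\mathcal P}E_P(X)$ for Borel $X$ and the capacity $\mathbb V(A)=\bar{\mathbb E}(I_A)$.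 The Choquet integral is $C_{\mathbb V}(X)=\int_0^\infty\mathbb V(X>x)\,dx+\int_{-\infty}^0(\mathbb V(X>x)-1)\,dx$. Independence: $Y$ is independent of $X=(X_1,\dots,X_m)$ if $\mathbb E[\psi(X,Y)]=\mathbb E[\mathbb E[\psi(x,Y)]|_{x=X}]$ for all locally Lipschitz $\psi$; a sequence is independent if $X_{n+1}$ is independent of $(X_1,\dots,X_n)$ for each $n$. Identically distributed: $\mathbb E[\psi(X_i)]=\mathbb E[\psi(X_1)]$ for all locally Lipschitz $\psi$ (whenever finite). Throughout, $\log n$ means $\log^+ n=\max(\log n,0)$. *)

(* Defs.v *)
From HB Require Import structures.
From mathcomp Require Import all_boot all_order all_algebra.
From mathcomp Require Import all_classical all_reals all_analysis.
Set Implicit Arguments. Unset Strict Implicit. Unset Printing Implicit Defensive.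
Import Order.TTheory GRing.Theory Num.Theory.
Local Open Scope classical_set_scope.
Local Open Scope ring_scope.

Section SubLinear.
Variable R : realType.

Definition vnorm n (x : 'I_n -> R) : R := \sum_(i < n) `|x i|.

Definition locLip n (phi : ('I_n -> R) -> R) : Prop :=
  exists (C : R) (m : nat), forall x y : 'I_n -> R,
    `|phi x - phi y| <= C * (1 + vnorm x ^+ m + vnorm y ^+ m)
                          * vnorm (fun i => x i - y i).

Definition snoc m (x : 'I_m -> R) (y : R) : 'I_m.+1 -> R :=
  fun i => oapp x y (insub (val i) : option 'I_m).

Variables (d : measure_display) (T : measurableType d).

Local Open Scope ereal_scope.

Definition sublinear_expectation_space (H : set (T -> R))
    (E : (T -> R) -> \bar R) : Prop :=
  (forall X, H X -> measurable_fun setT X) /\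
      (forall n (phi : ('I_n -> R) -> R) (Xs : 'I_n -> T -> R),
          locLip phi -> (forall i, H (Xs i)) -> H (fun w => phi (fun i => Xs i w))) /\
      (forall X Y, H X -> H Y -> (forall w, (X w <= Y w)%R) -> E X <= E Y) /\
      (forall c : R, E (fun _ => c) = c%:E) /\
      (forall (l : R) X, H X -> (0 <= l)%R -> E (fun w => l * X w)%R = l%:E * E X) /\
      (forall X Y, H X -> H Y -> adde_def (E X) (E Y) -> E (fun w => X w + Y w)%R <= E X + E Y).

Definition regular_sle (H : set (T -> R)) (E : (T -> R) -> \bar R) : Prop :=
  forall Xn : nat -> T -> R, (forall n, H (Xn n)) ->
    (forall n w, (Xn n.+1 w <= Xn n w)%R) ->
    (forall w, (fun n => Xn n w) @ \oo --> 0%R) ->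
    (fun n => E (Xn n)) @ \oo --> 0.

Definition countably_subadditive (H : set (T -> R)) (E : (T -> R) -> \bar R) : Prop :=
  forall (X : T -> R) (Xn : nat -> T -> R), H X -> (forall n, H (Xn n)) ->
    (forall n w, (0 <= Xn n w)%R) -> (forall w, (0 <= X w)%R) ->
    (forall w, (X w)%:E <= \sum_(n <oo) (Xn n w)%:E) ->
    E X <= \sum_(n <oo) E (Xn n).

Definition represents (Pfam : set (probability T R)) (H : set (T -> R))
    (E : (T -> R) -> \bar R) : Prop :=
  forall X, H X -> E X = ereal_sup [set \int[P]_w (X w)%:E | P in Pfam].

Definition capV (Pfam : set (probability T R)) (A : set T) : \bar R :=
  ereal_sup [set P A | P in Pfam].

Definition choquet (Pfam : set (probability T R)) (X : T -> R) : \bar R :=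
  (\int[lebesgue_measure]_(x in [set x : R | (0 <= x)%R])
      capV Pfam [set w | (x < X w)%R])
  + (\int[lebesgue_measure]_(x in [set x : R | (x < 0)%R])
      (capV Pfam [set w | (x < X w)%R] - 1)).

Definition indep_of (H : set (T -> R)) (E : (T -> R) -> \bar R) m
    (X : 'I_m -> T -> R) (Y : T -> R) : Prop :=
  forall psi : ('I_m.+1 -> R) -> R, locLip psi ->
    (forall x : 'I_m -> R, E (fun w => psi (snoc x (Y w))) \is a fin_num) ->
    E (fun w => psi (snoc (fun i => X i w) (Y w)))
    = E (fun w => fine (E (fun w' => psi (snoc (fun i => X i w) (Y w'))))).

(* X_{n+1} independent of (X_1,...,X_n) for every n (indices shifted to 0) *)
Definition indep_seq H E (Xs : nat -> T -> R) : Prop :=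
  forall n, @indep_of H E n (fun i : 'I_n => Xs (val i)) (Xs n).

Definition ident_distr (E : (T -> R) -> \bar R) (X Y : T -> R) : Prop :=
  forall psi : ('I_1 -> R) -> R, locLip psi ->
    E (fun w => psi (fun _ => X w)) \is a fin_num ->
    E (fun w => psi (fun _ => Y w)) \is a fin_num ->
    E (fun w => psi (fun _ => X w)) = E (fun w => psi (fun _ => Y w)).

End SubLinear.

Definition logp {R : realType} (x : R) : R := Num.max (ln x) 0.

(* Main.v *)
Require Import Defs.
From HB Require Import structures.
From mathcomp Require Import all_boot all_order all_algebra.
From mathcomp Require Import all_classical all_reals all_analysis.
From mathcomp Require Import measurable_realfun ring lra.
Set Implicit Arguments. Unset Strict Implicit. Unset Printing Implicit Defensive.
Import Order.TTheory GRing.Theory Num.Theory.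
Local Open Scope classical_set_scope.
Local Open Scope ring_scope.

(** Write [f x = exp((log+ x)^alpha)] and truncate at [N = b n] with
    [1 < b < eps].  Either some [|X_k|] with [k < n] exceeds [N], which costs at
    most [n V(|X| > n)], or [S_n] or [- S_n] is a sum of variables truncated
    above at [N].  For the latter use the exponential Markov inequality with the
    tilt [l = theta (log N)^alpha / N], [theta < 1]: as [(log z)^alpha / z]
    decreases, [l z <= theta (log z)^alpha] for large [z <= N], so that
    [exp(l min(x, N)) <= 1 + l x + C l^2 f|x|].  Since [E X = E(-X) = 0] and
    [E f|X|] is at most the Choquet integral, independence bounds the expected
    product by [(1 + C l^2)^n], which stays bounded because [n l^2] does.  The
    truncated part is thus [O(exp(- (1 + delta) (log n)^alpha))], which beats the
    weight.  For the jump part, [n] times the weight is [O(f n - f (n - 1))], and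
    the sum of [(f n - f (n - 1)) V(|X| > n)] is a lower sum of the Choquet
    integral of [f|X|]. *)

(** * Real estimates *)

Section RealBounds.
Context {R : realType}.
Implicit Types x y z u v p N a : R.

(** Raise [u / p <= expR (u / p)] to the power [p]. *)
Lemma powR_le_expR p u : 0 < p -> 0 <= u -> u `^ p <= p `^ p * expR u.
Proof.
move=> p0 u0.
have up : u <= p * expR (u / p).
  rewrite mulrC -ler_pdivrMr//.
  by apply: le_trans (expR_ge1Dx _); rewrite lerDr.
apply: (le_trans (ge0_ler_powR (ltW p0) _ _ up)); rewrite ?nnegrE//.
  by rewrite mulr_ge0 ?expR_ge0 ?ltW.
rewrite powRM ?expR_ge0 ?(ltW p0)//.
by rewrite -expRM divfK ?gt_eqF.
Qed.

(** Division-free form of the decrease of u^p e^(-u) past its maximum at [p]: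
    [v / u <= expR ((v - u) / u)], and the [p]-th power has exponent at most [v - u] since
    [p <= u]. *)
Lemma powR_expRN_nonincreasing p u v : 0 < p -> p <= u -> u <= v ->
  v `^ p * expR u <= u `^ p * expR v.
Proof.
move=> p0 pu uv; have u0 : 0 < u by apply: lt_le_trans pu.
have vu : v <= u * expR ((v - u) / u).
  rewrite mulrC -ler_pdivrMr//.
  apply: le_trans (expR_ge1Dx _).
  by rewrite mulrBl divff ?gt_eqF// addrC subrK.
have v0 : 0 <= v by rewrite (le_trans (ltW u0)).
have := ge0_ler_powR (ltW p0) _ _ vu; rewrite !nnegrE => /(_ v0).
rewrite mulr_ge0 ?expR_ge0 ?(ltW u0)// => /(_ isT).
rewrite powRM ?expR_ge0 ?(ltW u0)// -expRM => h.
have -> : expR v = expR (v - u) * expR u by rewrite -expRD subrK.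
rewrite mulrA ler_wpM2r ?expR_ge0// (le_trans h)// ler_wpM2l ?powR_ge0//.
rewrite ler_expR mulrAC ler_pdivrMr// ler_wpM2l// subr_ge0//.
Qed.

(** All comes from [expR y * (1 - y) <= 1]. For [y >= 0] use [expR y - 1 <= y * expR y] twice; for
    [y < 0] use [expR y <= 1 / (1 - y) <= 1 + y + y ^+ 2]. *)
Lemma expR_le_quadratic y : expR y <= 1 + y + y ^+ 2 * expR (Num.max y 0).
Proof.
have h : expR y * (1 - y) <= 1.
  have := expR_ge1Dx (- y).
  by rewrite expRN -[_^-1]div1r ler_pdivlMr ?expR_gt0// mulrC.
have ey := expR_gt0 y.
have [y0|y0] := leP 0 y.
  by nra.
by rewrite expR0; nra.
Qed.

(** Absorbs a square, |x|^2 <= exp(2 log+ |x|), into a small share [c] of the exponent of [explog].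
    The threshold [u0] solves c u^(a-1) = 2. *)
Lemma powR_dominates_linear a c : 1 < a -> 0 < c ->
  exists2 K : R, 0 <= K & forall u, 0 <= u -> 2 * u <= c * u `^ a + K.
Proof.
move=> a1 c0; set u0 := (2 / c) `^ (a - 1)^-1.
have a10 : 0 < a - 1 by rewrite subr_gt0.
exists (2 * u0); first by rewrite mulr_ge0// powR_ge0.
move=> u u_ge0; have [uu0|uu0] := leP u u0.
  by rewrite (@le_trans _ _ (2 * u0)) ?ler_wpM2l// lerDr mulr_ge0 ?powR_ge0 ?ltW.
have h : 2 / c <= u `^ (a - 1).
  have := ge0_ler_powR (ltW a10) _ _ (ltW uu0).
  rewrite !nnegrE => /(_ (powR_ge0 _ _) u_ge0); apply: le_trans.
  by rewrite -powRrM mulVf ?gt_eqF// powRr1// divr_ge0// ltW.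
rewrite -mulr_powRB1 ?(lt_trans _ a1)//.
rewrite (@le_trans _ _ (c * (u * u `^ (a - 1))))// ?lerDl ?mulr_ge0 ?powR_ge0//.
rewrite mulrCA mulrC ler_wpM2l//.
by rewrite mulrC -ler_pdivrMr.
Qed.

Lemma logp_ge0 x : 0 <= logp x.
Proof. by rewrite /logp le_max lexx orbT. Qed.

Lemma logp_ln x : 1 <= x -> logp x = ln x.
Proof. by move=> x1; rewrite /logp max_l// ln_ge0. Qed.

Lemma logp_small x : x <= 1 -> logp x = 0.
Proof. by move=> x1; rewrite /logp max_r// ln_le0. Qed.

Lemma le_logp x y : x <= y -> logp x <= logp y.
Proof.
move=> xy; have [x1|x1] := leP x 1; first by rewrite (@logp_small x)// logp_ge0.
have y1 : 1 <= y by rewrite (le_trans _ xy)// ltW.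
by rewrite !logp_ln ?(ltW x1)// ler_ln// posrE (lt_le_trans ltr01)// ltW.
Qed.

Lemma le_expR_logp x : x <= expR (logp x).
Proof.
have [x1|x1] := leP x 1; first by rewrite (le_trans x1)// logp_small// expR0.
by rewrite logp_ln ?(ltW x1)// lnK// posrE (lt_trans ltr01).
Qed.

Lemma expR_logp x : 1 <= x -> expR (logp x) = x.
Proof. by move=> x1; rewrite logp_ln// lnK// posrE (lt_le_trans ltr01). Qed.

Definition explog (a x : R) : R := expR (logp x `^ a).

Lemma le_explog a x y : 0 <= a -> x <= y -> explog a x <= explog a y.
Proof.
move=> a0 xy; rewrite ler_expR ge0_ler_powR// ?nnegrE ?logp_ge0//.
exact: le_logp.
Qed.

Lemma lt_explog a x y : 0 < a -> 1 <= x -> x < y -> explog a x < explog a y.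
Proof.
move=> a0 x1 xy; have y1 : 1 <= y by rewrite (le_trans x1)// ltW.
rewrite ltr_expR gt0_ltr_powR// ?nnegrE ?logp_ge0//.
by rewrite !logp_ln// ltr_ln// posrE (lt_le_trans ltr01).
Qed.

Definition tilt (theta a N : R) : R := theta * (logp N `^ a / N).

Lemma tilt_ge0 theta a N : 0 <= theta -> 0 <= N -> 0 <= tilt theta a N.
Proof. by move=> t0 N0; rewrite mulr_ge0// divr_ge0// powR_ge0. Qed.

Lemma logp_powR_le a N : 0 < a -> 1 <= N -> logp N `^ a <= a `^ a * N.
Proof.
by move=> a0 N1; rewrite -{2}(expR_logp N1) powR_le_expR// logp_ge0.
Qed.

(* [(log z)^a / z] is nonincreasing for [z >= e^a], so the tilt at level [N]
   costs at most [theta (log z)^a] at every smaller level [z]. *)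
Lemma tilt_mul_le theta a N z w : 0 < a -> 0 < theta < 1 -> 1 <= N ->
  0 <= z -> z <= N -> z <= w ->
  tilt theta a N * z <= theta * logp w `^ a + a `^ a * expR a.
Proof.
move=> a0 /andP[t0 t1] N1 z0 zN zw.
have N0 : 0 < N by rewrite (lt_le_trans ltr01).
(* Below [expR a] crude bounds suffice: [logp_powR_le] bounds the tilt by a^a, and [z] is at most
   [expR a]. *)
have [za|za] := leP z (expR a).
  rewrite (@le_trans _ _ (a `^ a * expR a)) ?lerDr ?mulr_ge0 ?powR_ge0 ?(ltW t0)//.
  rewrite ler_pM ?tilt_ge0 ?(ltW t0) ?(ltW N0) ?(ltW za)//.
  rewrite /tilt -[leRHS]mul1r ler_pM ?(ltW t0) ?(ltW t1)//.
    by rewrite divr_ge0 ?powR_ge0// ltW.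
  by rewrite ler_pdivrMr// logp_powR_le.
have z1 : 1 <= z.
  by rewrite ltW// (le_lt_trans _ za)// -expR0 ler_expR ltW.
rewrite (@le_trans _ _ (theta * logp w `^ a)) ?lerDl ?mulr_ge0 ?powR_ge0 ?expR_ge0//.
rewrite /tilt -mulrA ler_wpM2l ?(ltW t0)//.
rewrite (@le_trans _ _ (logp z `^ a))//; last first.
  by rewrite ge0_ler_powR ?(ltW a0)// ?nnegrE ?logp_ge0// le_logp.
rewrite mulrAC ler_pdivrMr//.
have := @powR_expRN_nonincreasing a (logp z) (logp N) a0.
rewrite !expR_logp//; apply; last exact: le_logp.
by rewrite -ler_expR expR_logp// ltW.
Qed.

Lemma expR_tilt_le theta a : 1 < a -> 0 < theta < 1 ->
  exists2 C : R, 0 <= C & forall N x, 1 <= N ->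
    expR (tilt theta a N * Num.min x N) <=
    1 + tilt theta a N * x + C * tilt theta a N ^+ 2 * explog a `|x|.
Proof.
move=> a1 t01; have a0 : 0 < a by rewrite (lt_trans ltr01).
case/andP : (t01) => t0 t1.
(* The tilt spends the share [theta] of the exponent of [explog]; the remaining [1 - theta] pays for
   the factor [z ^+ 2]. *)
have [K K0 hK] : exists2 K : R, 0 <= K &
    forall u, 0 <= u -> 2 * u <= (1 - theta) * u `^ a + K.
  by apply: powR_dominates_linear; rewrite ?subr_gt0.
exists (expR (a `^ a * expR a + K)); first exact: expR_ge0.
move=> N x N1; have N0 : 0 < N by rewrite (lt_le_trans ltr01).
have l0 : 0 <= tilt theta a N by rewrite tilt_ge0 ?(ltW t0) ?(ltW N0).
set z := Num.min x N.
have zx : z ^+ 2 <= `|x| ^+ 2.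
  rewrite -[z ^+ 2]real_normK ?num_real// ler_sqr ?nnegrE//.
  rewrite /z; have [//|Nx] := leP x N.
  by rewrite (gtr0_norm N0) (le_trans (ltW Nx))// ler_norm.
have h1 : tilt theta a N * Num.max z 0 <=
    theta * logp `|x| `^ a + a `^ a * expR a.
  apply: tilt_mul_le => //; rewrite ?le_max ?lexx ?orbT// ge_max.
    by rewrite /z ge_min lexx orbT ltW.
  by rewrite normr_ge0 andbT /z ge_min ler_norm.
have h2 : `|x| ^+ 2 <= expR (2 * logp `|x|).
  by rewrite expRM_natl ler_sqr ?nnegrE ?expR_ge0// le_expR_logp.
have h3 := hK _ (logp_ge0 `|x|).
move: (tilt theta a N) l0 h1 => l l0 h1.
apply: (le_trans (expR_le_quadratic _)); rewrite -addrA -[leRHS]addrA lerD2l.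
(* Truncation from above only lowers the linear term, so [x] itself, whose mean will vanish, may
   replace [z]. *)
apply: lerD; first by rewrite ler_wpM2l// /z ge_min lexx.
have -> : Num.max (l * z) 0 = l * Num.max z 0 by rewrite maxr_pMr// mulr0.
rewrite exprMn; move: (l ^+ 2) (sqr_ge0 l) => l2 l20.
rewrite -(mulrA l2) -(mulrA _ l2) [leRHS]mulrCA ler_wpM2l//.
rewrite (le_trans (ler_pM _ _ (le_trans zx h2) (lexx _))) ?sqr_ge0 ?expR_ge0//.
rewrite -!expRD ler_expR.
move: (logp `|x| `^ a) h1 h3 => L; move: (a `^ a * _) => M; lra.
Qed.

(* Bounds below the increments of [explog], through
   [(log (n+1))^a - (log n)^a >= (log (n+1))^(a-1) / (n+1)] and
   [1 - e^-D >= D / (1 + D)]. *)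
Lemma explog_increment a : 1 < a -> exists2 K : R, 0 <= K & forall n : nat,
  explog a n.+1%:R * logp (n.+1%:R : R) `^ (a - 1) / n.+1%:R <=
  K * (explog a n.+1%:R - explog a n%:R).
Proof.
move=> a1; have a0 : 0 < a by rewrite (lt_trans ltr01).
have a10 : 0 < a - 1 by rewrite subr_gt0.
(* This constant bounds [1 + D0] for the [D0] set below. *)
exists (1 + (a - 1) `^ (a - 1)); first by rewrite addr_ge0 ?powR_ge0.
(* At [n = 0] the left side vanishes, as [logp 1 = 0] and [a - 1 > 0]. *)
case=> [|n].
  rewrite (@logp_small 1)// powR0 ?gt_eqF// mulr0 mul0r.
  by apply: mulr_ge0; rewrite ?subr_ge0 ?le_explog ?(ltW a0)// addr_ge0 ?powR_ge0.
set u := logp (n.+2%:R : R); set v := logp (n.+1%:R : R).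
have vu : v <= u by rewrite le_logp// ler_nat.
have v0 : 0 <= v := logp_ge0 _. have u0 : 0 <= u := logp_ge0 _.
(* The difference is -ln(1 - 1/(n+2)), and ln(1 + t) <= t. *)
have duv : (n.+2%:R)^-1 <= u - v.
  rewrite /u /v !logp_ln ?ler1n//.
  have := @le_ln1Dx R (- (n.+2%:R)^-1).
  rewrite ltrN2 invf_lt1 ?ltr1n ?ltr0n// => /(_ isT).
  have -> : 1 - n.+2%:R^-1 = n.+1%:R / n.+2%:R :> R.
    have n0 : n.+2%:R != 0 :> R by rewrite pnatr_eq0.
    apply: (mulIf n0); rewrite mulrBl mul1r mulVf// divfK//.
    by rewrite -natr1 addrK.
  by rewrite ln_div ?posrE ?ltr0n// lerNr opprB.
set D0 := u `^ (a - 1) / n.+2%:R.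
have D00 : 0 <= D0 by rewrite divr_ge0 ?powR_ge0.
have D0b : D0 <= (a - 1) `^ (a - 1).
  by rewrite ler_pdivrMr ?ltr0n// logp_powR_le// ler1n.
have D0D : D0 <= u `^ a - v `^ a.
  rewrite -(mulr_powRB1 u0 a0) -(mulr_powRB1 v0 a0).
  have pv : v `^ (a - 1) <= u `^ (a - 1).
    by rewrite ge0_ler_powR ?nnegrE// ltW.
  rewrite (@le_trans _ _ (u `^ (a - 1) * (u - v)))//.
    by rewrite ler_wpM2l ?powR_ge0.
  by have := ler_wpM2l v0 pv; lra.
rewrite -mulrA -/D0 /explog -/u -/v.
have -> : expR (v `^ a) = expR (u `^ a) * expR (- (u `^ a - v `^ a)).
  by rewrite -expRD; congr expR; lra.
rewrite -[X in _ * (X - _)]mulr1 -mulrBr [leRHS]mulrCA ler_wpM2l ?expR_ge0//.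
have := expR_ge1Dx D0; have : expR (- (u `^ a - v `^ a)) <= expR (- D0).
  by rewrite ler_expR lerN2.
rewrite [in X in _ <= X -> _]expRN; set e := expR (- _); set g := expR D0 => he hg.
have g0 : 0 < g by exact: expR_gt0.
have gi : g^-1 <= (1 + D0)^-1 by rewrite lef_pV2// posrE; lra.
have h : e <= (1 + D0)^-1 by lra.
have hd : (1 + D0)^-1 * (1 + D0) = 1 by rewrite mulVf// gt_eqF//; lra.
have : D0 <= (1 + (a - 1) `^ (a - 1)) * (1 - (1 + D0)^-1).
  have di0 : 0 <= (1 + D0)^-1 by rewrite invr_ge0; lra.
  have di1 : (1 + D0)^-1 <= 1 by rewrite invf_le1; lra.
  set i := (1 + D0)^-1 in hd di0 di1 *.
  have -> : D0 = (1 + D0) * (1 - i) by lra.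
  by rewrite ler_wpM2r; lra.
move=> /le_trans; apply; rewrite ler_wpM2l ?addr_ge0 ?powR_ge0//; lra.
Qed.

(** Lets the surplus factor exp(-c u^a) absorb the power of the logarithm in the weight: with y =
    u^a, u^(a-1) <= 1 + y and y e^(-cy) <= 1/c. *)
Lemma powR_mul_expRN_bounded a c : 1 < a -> 0 < c ->
  exists2 K : R, 0 <= K &
    forall u, 0 <= u -> u `^ (a - 1) * expR (- (c * u `^ a)) <= K.
Proof.
move=> a1 c0; exists (1 + c^-1); first by rewrite addr_ge0// invr_ge0 ltW.
move=> u u0; set y := u `^ a; have y0 : 0 <= y := powR_ge0 _ _.
have h1 : u `^ (a - 1) <= 1 + y.
  have [u1|u1] := leP u 1.
    rewrite (@le_trans _ _ 1) ?lerDl//.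
    have := @ge0_ler_powR R (a - 1) _ u 1; rewrite !nnegrE powR1 subr_ge0.
    by apply => //; rewrite ltW.
  rewrite (@le_trans _ _ y) ?lerDr//.
  by rewrite ler_powR ?(ltW u1)// gerBl.
have e1 : expR (- (c * y)) <= 1.
  by rewrite expR_le1 oppr_le0 mulr_ge0// ltW.
have e2 : y * expR (- (c * y)) <= c^-1.
  rewrite expRN ler_pdivrMr ?expR_gt0// mulrC -ler_pdivrMr ?invr_gt0// invrK.
  by rewrite mulrC (le_trans _ (expR_ge1Dx _))// lerDr.
have e0 := expR_ge0 (- (c * y)).
apply: le_trans (ler_wpM2r e0 h1) _; rewrite mulrDl mul1r; exact: lerD.
Qed.

End RealBounds.

(** * Lipschitz functions and independence *)

Section Lipschitz.
Context {R : realType}.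

Definition lip (phi : R -> R) : Prop :=
  exists2 L : R, 0 <= L & forall x y, `|phi x - phi y| <= L * `|x - y|.

Lemma lip_cst (c : R) : lip (fun=> c).
Proof. by exists 0 => // x y; rewrite subrr normr0 mul0r. Qed.

Lemma locLip_lipschitz n (psi : ('I_n -> R) -> R) (C : R) :
  (forall x y, `|psi x - psi y| <= C * vnorm (fun i => x i - y i)) ->
  locLip psi.
Proof.
(* With exponent [m = 0] the bracket in [locLip] equals 3. *)
move=> h; exists (C / 3), 0 => x y; rewrite !expr0.
by rewrite (_ : C / 3 * (1 + 1 + 1) = C)//; field.
Qed.

Lemma locLip1 (phi : R -> R) : lip phi ->
  locLip (fun x : 'I_1 -> R => phi (x ord0)).
Proof.
case=> L L0 h; apply: (@locLip_lipschitz _ _ L) => x y.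
by rewrite /vnorm big_ord1.
Qed.

(** Exchange one factor at a time; [1 <= B] lets [B ^+ n] dominate every shorter product. *)
Lemma prod_sub_le n (u v : 'I_n -> R) (B : R) : 1 <= B ->
  (forall i, `|u i| <= B) -> (forall i, `|v i| <= B) ->
  `|\prod_i u i - \prod_i v i| <= B ^+ n * \sum_i `|u i - v i|.
Proof.
move=> B1; have B0 : 0 <= B by rewrite (le_trans ler01).
elim: n u v => [|n IH] u v uB vB.
  by rewrite !big_ord0 subrr normr0 mulr0.
rewrite !big_ord_recr /=; set U := \prod_(i < n) _; set V := \prod_(i < n) v _.
set S := \sum_(i < n) _.
have UV : `|U - V| <= B ^+ n * S by exact: IH.
have UB : `|U| <= B ^+ n.
  have -> : B ^+ n = \prod_(i < n) B by rewrite prodr_const card_ord.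
  rewrite normr_prod ler_prod// => i _.
  by rewrite normr_ge0 uB.
rewrite (_ : _ - _ = U * (u ord_max - v ord_max) + (U - V) * v ord_max);
  last by ring.
rewrite (le_trans (ler_normD _ _))// !normrM mulrDr addrC lerD//.
  by rewrite exprSr mulrAC ler_pM.
by rewrite ler_wpM2r// (le_trans UB)// exprS ler_peMl// exprn_ge0.
Qed.

Lemma locLip_prod n (phi : R -> R) (B : R) : lip phi ->
  (forall x, 0 <= phi x <= B) ->
  locLip (fun x : 'I_n -> R => \prod_i phi (x i)).
Proof.
case=> L L0 hL hB; set B' := Num.max B 1.
have B1 : 1 <= B' by rewrite le_max lexx orbT.
have hB' x : `|phi x| <= B'.
  by have /andP[p0 pB] := hB x; rewrite ger0_norm// le_max pB.
apply: (@locLip_lipschitz _ _ (B' ^+ n * L)) => x y.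
apply: le_trans (prod_sub_le B1 _ _) _ => //.
rewrite -mulrA ler_wpM2l ?exprn_ge0 ?(le_trans ler01)//.
by rewrite /vnorm mulr_sumr ler_sum.
Qed.

Lemma expR_sub_le (a b : R) : b <= a -> expR a - expR b <= expR a * (a - b).
Proof.
move=> ba; have := expR_ge1Dx (b - a); have := expR_gt0 a.
have -> : expR b = expR a * expR (b - a) by rewrite -expRD; congr expR; ring.
move=> a0 h; have := ler_wpM2l (ltW a0) h; lra.
Qed.

(** Truncating above at [N] caps the slope at [l * expR (l * N)], which makes the exponential an
    admissible test function. *)
Lemma lip_expR_trunc (l N : R) : 0 <= l ->
  lip (fun x => expR (l * Num.min x N)).
Proof.
move=> l0; exists (expR (l * N) * l) => [|x y]; first by rewrite mulr_ge0 ?expR_ge0.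
wlog xy : x y / y <= x => [h|].
  have [/h//|/ltW /h] := leP y x.
  by rewrite distrC (distrC x).
have mxy : Num.min y N <= Num.min x N by rewrite le_min !ge_min xy lexx orbT.
have lm : l * Num.min y N <= l * Num.min x N by rewrite ler_wpM2l.
rewrite !ger0_norm ?subr_ge0// ?ler_expR//.
rewrite (le_trans (expR_sub_le lm))// -mulrA ler_pM ?expR_ge0// ?subr_ge0//.
  by rewrite ler_expR ler_wpM2l// ge_min lexx orbT.
rewrite -mulrBr ler_wpM2l//.
by have [?|?] := leP x N; have [?|?] := leP y N; lra.
Qed.

Lemma snoc_widen m (x : 'I_m -> R) (y : R) (i : 'I_m) :
  snoc x y (widen_ord (leqnSn m) i) = x i.
Proof. by rewrite /snoc /= valK. Qed.

Lemma snoc_max m (x : 'I_m -> R) (y : R) : snoc x y ord_max = y.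
Proof. by rewrite /snoc /= insubF// ltnn. Qed.

Lemma snoc_val m (F : nat -> R) :
  snoc (fun i : 'I_m => F (val i)) (F m) = (fun i => F (val i)).
Proof.
apply/funext => i; rewrite /snoc; case: insubP => [j _ <- //|].
by rewrite -leqNgt => mi /=; congr F; apply/eqP; rewrite eqn_leq mi -ltnS ltn_ord.
Qed.

End Lipschitz.

(** * Expectation, capacity and Choquet integral *)

Section UpperExpectation.
Context {R : realType} {d : measure_display} {T : measurableType d}.
Variables (H : set (T -> R)) (E : (T -> R) -> \bar R).
Variable Pfam : set (probability T R).
Hypotheses (hS : sublinear_expectation_space H E) (hP : represents Pfam H E).
Local Open Scope ereal_scope.

Let measurableH Y : H Y -> measurable_fun setT Y.
Proof. exact: hS.1. Qed.

Lemma H_locLip n (psi : ('I_n -> R) -> R) (Ys : 'I_n -> T -> R) :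
  locLip psi -> (forall i, H (Ys i)) -> H (fun w => psi (fun i => Ys i w)).
Proof. exact: hS.2.1. Qed.

Lemma H_lip phi Y : lip phi -> H Y -> H (fun w => phi (Y w)).
Proof.
by move=> /locLip1 h hY; exact: (@H_locLip 1 _ (fun=> Y) h).
Qed.

Lemma E_cst c : E (fun=> c) = c%:E.
Proof. exact: hS.2.2.2.1. Qed.

Lemma le_E Y Z : H Y -> H Z -> (forall w, (Y w <= Z w)%R) -> E Y <= E Z.
Proof. exact: hS.2.2.1. Qed.

Lemma E_scale l Y : H Y -> (0 <= l)%R -> E (fun w => l * Y w)%R = l%:E * E Y.
Proof. exact: hS.2.2.2.2.1. Qed.

(** Supplies the finiteness conditions in [ident_distr] and [indep_of]. *)
Lemma E_bounded phi Y (B : R) : lip phi -> H Y ->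
  (forall x, 0 <= phi x <= B)%R ->
  (0 <= E (fun w => phi (Y w)) <= B%:E) /\ E (fun w => phi (Y w)) \is a fin_num.
Proof.
move=> hphi hY hB.
have bnd : 0 <= E (fun w => phi (Y w)) <= B%:E.
  apply/andP; split; [rewrite -[leLHS]/(0%:E) -(E_cst 0)|rewrite -(E_cst B)]; apply: le_E.
  - exact: (H_lip (lip_cst 0) hY).
  - exact: H_lip.
  - by move=> w; have /andP[] := hB (Y w).
  - exact: H_lip.
  - exact: (H_lip (lip_cst B) hY).
  - by move=> w; have /andP[] := hB (Y w).
split=> //; have /andP[b0 bB] := bnd.
by rewrite ge0_fin_numE// (le_lt_trans bB)// ltry.
Qed.

Lemma E_ident phi X Y (B : R) : lip phi -> H X -> H Y -> ident_distr E Y X ->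
  (forall x, 0 <= phi x <= B)%R ->
  E (fun w => phi (Y w)) = E (fun w => phi (X w)).
Proof.
move=> hphi hX hY hid hB; apply: (hid (fun x => phi (x ord0))).
- exact: locLip1.
- by case: (E_bounded hphi hY hB).
- by case: (E_bounded hphi hX hB).
Qed.

(** Induction on [m]: with the first coordinates frozen, their product is a constant that positive
    homogeneity pulls out of [E], because [phi] is nonnegative. *)
Lemma E_prod_indep phi X (Xs : nat -> T -> R) (B : R) m : lip phi -> H X ->
  (forall k, H (Xs k)) -> indep_seq H E Xs -> (forall k, ident_distr E (Xs k) X) ->
  (forall x, 0 <= phi x <= B)%R ->
  E (fun w => \prod_(k < m) phi (Xs k w))%R
  = (fine (E (fun w => phi (X w))) ^+ m)%:E.
Proof.
move=> hphi hX hXs hind hid hB.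
have fin Y : H Y -> E (fun w => phi (Y w)) \is a fin_num.
  by move=> hY; case: (E_bounded hphi hY hB).
have HP n : H (fun w => \prod_(k < n) phi (Xs k w))%R.
  exact: (H_locLip (locLip_prod n hphi hB) (fun k : 'I_n => hXs k)).
have splitE n (x : 'I_n -> R) y :
    (\prod_(i < n.+1) phi (snoc x y i) = (\prod_(i < n) phi (x i)) * phi y)%R.
  rewrite big_ord_recr /= snoc_max; congr (_ * _)%R.
  by apply: eq_bigr => i _; rewrite snoc_widen.
have prod_ge0 n (x : 'I_n -> R) : (0 <= \prod_(i < n) phi (x i))%R.
  by apply: prodr_ge0 => i _; have /andP[] := hB (x i).
have EPs n (x : 'I_n -> R) :
    E (fun w => \prod_(i < n.+1) phi (snoc x (Xs n w) i))%R =
    (\prod_(i < n) phi (x i) * fine (E (fun w => phi (X w))))%:E.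
  under [in LHS]eq_fun do rewrite splitE.
  rewrite E_scale//; last exact: H_lip.
  by rewrite (E_ident hphi hX (hXs n) (hid n) hB) EFinM fineK ?fin.
elim: m => [|m IH].
  by under eq_fun do rewrite big_ord0; rewrite E_cst expr0.
have fEP (x : 'I_m -> R) :
    E (fun w => \prod_(i < m.+1) phi (snoc x (Xs m w) i))%R \is a fin_num.
  by rewrite EPs.
have := hind m (fun x => \prod_(i < m.+1) phi (x i))%R (locLip_prod m.+1 hphi hB) fEP.
under eq_fun do rewrite (snoc_val m (fun k => Xs k _)).
move=> ->.
under eq_fun do rewrite EPs /= mulrC.
rewrite (E_scale (HP m)) ?IH ?exprS ?EFinM//.
by rewrite fine_ge0//; have [/andP[]] := E_bounded hphi hX hB.
Qed.

(** The indicator of [A] may lie outside [H], so it is compared with [g] under each [P] before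
    taking the supremum. *)
Lemma capV_le_E (A : set T) (g : T -> R) : measurable A -> H g ->
  (forall w, 0 <= g w)%R -> (forall w, A w -> 1 <= g w)%R ->
  capV Pfam A <= E g.
Proof.
move=> mA hg g0 g1; apply: ge_ereal_sup => _ [P PP <-].
rewrite hP//; apply: (@le_trans _ _ (\int[P]_w (g w)%:E)); last first.
  by apply: ereal_sup_ubound; exists P.
have -> : P A = \int[P]_w (\1_A w)%:E by rewrite integral_indic// setIT.
apply: ge0_le_integral => //.
- by apply/measurable_EFinP; exact: measurable_indic.
- by apply/measurable_EFinP; exact: measurableH.
move=> w _; rewrite lee_fin indicE.
by have [|] := boolP (w \in A); rewrite ?inE => //= /g1.
Qed.

Lemma E_le_capV (A : set T) (g : T -> R) : measurable A -> H g ->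
  (forall w, 0 <= g w <= \1_A w)%R -> E g <= capV Pfam A.
Proof.
move=> mA hg hgA; rewrite hP//; apply: ge_ereal_sup => _ [P PP <-].
apply: (@le_trans _ _ (P A)); last by apply: ereal_sup_ubound; exists P.
have -> : P A = \int[P]_w (\1_A w)%:E by rewrite integral_indic// setIT.
apply: ge0_le_integral => //.
- by move=> w _; rewrite lee_fin; have /andP[] := hgA w.
- by apply/measurable_EFinP; exact: measurableH.
- by apply/measurable_EFinP; exact: measurable_indic.
by move=> w _; rewrite lee_fin; have /andP[] := hgA w.
Qed.

Lemma measurable_gt (x : R) (Y : T -> R) : measurable_fun setT Y ->
  measurable [set w | (x < Y w)%R].
Proof.
move=> mY; rewrite -[X in measurable X]setTI.
have -> : [set w | (x < Y w)%R] = Y @^-1` `]x, +oo[%classic.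
  by apply/seteqP; split=> w /=; rewrite in_itv/= andbT.
exact: mY.
Qed.

(** Over an empty family the supremum would be -oo, whereas [E] of the constant 0 is 0. *)
Lemma Pfam_neq0 Y : H Y -> Pfam !=set0.
Proof.
move=> hY; apply/set0P/eqP => P0.
by have := hP (H_lip (lip_cst 0) hY); rewrite E_cst P0 image_set0 ereal_sup0.
Qed.

Lemma capV_ge0 A : Pfam !=set0 -> 0 <= capV Pfam A.
Proof.
case=> P PP; apply: (@le_trans _ _ (P A)) => //.
by apply: ereal_sup_ubound; exists P.
Qed.

Lemma capV_le1 A : measurable A -> capV Pfam A <= 1.
Proof.
by move=> mA; apply: ge_ereal_sup => _ [P PP <-]; exact: probability_le1.
Qed.

Lemma prob_le_capV (P : probability T R) A : Pfam P -> P A <= capV Pfam A.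
Proof. by move=> PP; apply: ereal_sup_ubound; exists P. Qed.

Lemma le_capV A B : measurable A -> measurable B -> A `<=` B ->
  capV Pfam A <= capV Pfam B.
Proof.
move=> mA mB AB; apply: ge_ereal_sup => _ [P PP <-].
apply: le_trans (prob_le_capV _ PP).
by apply: le_measure; rewrite ?inE.
Qed.

Lemma capV_fin A : Pfam !=set0 -> measurable A -> capV Pfam A \is a fin_num.
Proof.
move=> P0 mA; rewrite ge0_fin_numE ?capV_ge0//.
by rewrite (le_lt_trans (capV_le1 mA))// ltry.
Qed.

(** The union bound holds under each [P] and passes to the supremum. The sets [J k] will be the
    jumps, [A] and [B] the two signs of the truncated sum. *)
Lemma capV_bigsetU_le n (J : nat -> set T) (c : \bar R) (A B C : set T) :
  (forall k, measurable (J k)) -> measurable A -> measurable B -> measurable C ->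
  (forall k, capV Pfam (J k) <= c) ->
  C `<=` \big[setU/set0]_(k < n) J k `|` (A `|` B) ->
  capV Pfam C <= n%:R%:E * c + (capV Pfam A + capV Pfam B).
Proof.
move=> mJ mA mB mC Jc CJ; apply: ge_ereal_sup => _ [P PP <-].
have mU : measurable (\big[setU/set0]_(k < n) J k).
  by apply: bigsetU_measurable.
apply: (@le_trans _ _ (P (\big[setU/set0]_(k < n) J k `|` (A `|` B)))).
  by apply: le_measure; rewrite ?inE//; do 2?apply: measurableU.
apply: (le_trans (measureU2 _ _ _)) => //; first exact: measurableU.
apply: leeD.
  apply: (le_trans (Boole_inequality P _)) => //.
  apply: (@le_trans _ _ (\sum_(k < n) c)).
    by apply: lee_sum => k _; exact: le_trans (prob_le_capV _ PP) (Jc k).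
  by rewrite sumr_const card_ord mule_natl.
apply: (le_trans (measureU2 _ _ _)) => //.
by apply: leeD; exact: prob_le_capV.
Qed.

(** Monotonicity in [x] gives measurability; a supremum over an arbitrary family need not be
    measurable. *)
Lemma measurable_capV_tail (Y : T -> R) : Pfam !=set0 -> measurable_fun setT Y ->
  measurable_fun setT (fun x : R => capV Pfam [set w | (x < Y w)%R]).
Proof.
move=> P0 mY.
have -> : (fun x : R => capV Pfam [set w | (x < Y w)%R]) =
    EFin \o (fun x => fine (capV Pfam [set w | (x < Y w)%R])).
  by apply/funext => x /=; rewrite fineK// capV_fin//; exact: measurable_gt.
apply/measurable_EFinP; apply: nonincreasing_measurable => // x y xy.
apply: fine_le; rewrite ?capV_fin//; try exact: measurable_gt.
by apply: le_capV; try exact: measurable_gt; move=> w /=; exact: le_lt_trans.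
Qed.

Lemma choquet_ge0 (Y : T -> R) : Pfam !=set0 -> measurable_fun setT Y ->
  (forall w, 0 <= Y w)%R ->
  choquet Pfam Y =
  \int[lebesgue_measure]_(x in `[0%R, +oo[) capV Pfam [set w | (x < Y w)%R].
Proof.
move=> P0 mY Y0; rewrite /choquet.
have -> : [set x : R | (0 <= x)%R] = `[0%R, +oo[%classic.
  by apply/seteqP; split=> x /=; rewrite in_itv/= andbT.
(* For [x < 0] the event is the whole space, of capacity 1, so the negative half contributes
   nothing. *)
rewrite [X in _ + X]integral0_eq ?adde0// => x /= x0.
have -> : [set w | (x < Y w)%R] = setT.
  by apply/seteqP; split=> // w _ /=; exact: lt_le_trans (Y0 w).
case: P0 => P PP; rewrite (_ : capV _ _ = 1) ?subee//.
apply/le_anti; rewrite capV_le1//=.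
by rewrite -(@probability_setT _ _ _ P) prob_le_capV.
Qed.

(** Layer-cake formula under [P], then [P] is raised to the capacity inside the integral. It applies
    to [explog], whose growth exceeds every polynomial. *)
Lemma integral_le_choquet (P : probability T R) (Y : T -> R) : Pfam P ->
  measurable_fun setT Y -> (forall w, 0 <= Y w)%R ->
  \int[P]_w (Y w)%:E <= choquet Pfam Y.
Proof.
move=> PP mY Y0; have P0 : Pfam !=set0 by exists P.
rewrite choquet_ge0//.
pose Z : {RV P >-> R} := mfun_Sub (mem_set mY).
have := @ge0_expectation_ccdf _ _ _ P Z Y0.
rewrite unlock => ->; apply: ge0_le_integral => //.
- by apply: measurable_funTS; exact: ccdf_measurable.
- by apply: measurable_funTS; exact: measurable_capV_tail.
move=> x _; apply: le_trans (prob_le_capV _ PP).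
rewrite /ccdf /distribution /pushforward; apply: le_measure; rewrite ?inE//.
- by rewrite -[X in measurable X]setTI; exact: (mY measurableT).
- exact: measurable_gt.
by move=> w /=; rewrite in_itv/= andbT.
Qed.

End UpperExpectation.

(** * Truncated sums *)

Section TailBounds.
Context {R : realType} {d : measure_display} {T : measurableType d}.
Variables (H : set (T -> R)) (E : (T -> R) -> \bar R).
Variable Pfam : set (probability T R).
Hypotheses (hS : sublinear_expectation_space H E) (hP : represents Pfam H E).

Let measurableH Y : H Y -> measurable_fun setT Y.
Proof. exact: hS.1. Qed.

Lemma measurable_explog a (Y : T -> R) : measurable_fun setT Y ->
  measurable_fun setT (fun w => explog a `|Y w|).
Proof.
move=> mY; have mL : measurable_fun setT (fun w => logp `|Y w|).
  apply: measurable_maxr => //; apply: (measurableT_comp (@measurable_ln R)).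
  exact: measurableT_comp.
have mp := measurableT_comp (@measurable_powR R a) mL.
exact: (measurableT_comp (@measurable_expR R) mp).
Qed.

(** Gives integrability of the variable itself under each [P], so that the linear term can be
    integrated separately. *)
Lemma le_explog_abs a : 1 < a ->
  exists2 K : R, 0 <= K & forall x : R, `|x| <= K * explog a `|x|.
Proof.
move=> a1; have [K K0 hK] := powR_dominates_linear a1 (ltr0n R 2).
exists (expR (K / 2)) => [|x]; first exact: expR_ge0.
rewrite (le_trans (le_expR_logp _))// -expRD ler_expR.
have := hK _ (logp_ge0 `|x|); lra.
Qed.

Lemma integrable_explog (P : probability T R) a (Z : T -> R) (M : R) :
  measurable_fun setT Z ->
  (\int[P]_w (explog a `|Z w|)%:E <= M%:E)%E ->
  P.-integrable setT (EFin \o (fun w => explog a `|Z w|)).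
Proof.
move=> mZ hM; apply/integrableP; split.
  by apply/measurable_EFinP; exact: measurable_explog.
under eq_integral do rewrite /= ger0_norm ?expR_ge0//.
by rewrite (le_lt_trans hM)// ltry.
Qed.

(** Integrate [expR_tilt_le] under each [P] and take the supremum; [C] depends on neither [Z] nor
    [N]. *)
Lemma E_expR_trunc_le theta a : 1 < a -> 0 < theta < 1 ->
  exists2 C : R, 0 <= C & forall (Z : T -> R) (M : R), H Z -> E Z = 0%E ->
    (forall P, Pfam P -> (\int[P]_w (explog a `|Z w|)%:E <= M%:E)%E) ->
    forall N, 1 <= N ->
    fine (E (fun w => expR (tilt theta a N * Num.min (Z w) N)))
      <= 1 + C * M * tilt theta a N ^+ 2.
Proof.
move=> a1 t01; have [C C0 hC] := expR_tilt_le a1 t01.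
exists C => // Z M hZ EZ hM N N1.
have mZ := measurableH hZ.
have l0 : 0 <= tilt theta a N.
  by case/andP : t01 => /ltW t0 _; rewrite tilt_ge0 ?(le_trans ler01 N1).
have := fun x => hC N x N1; move: (tilt theta a N) l0 => l l0 {}hC.
have hphi : lip (fun x => expR (l * Num.min x N)) := lip_expR_trunc N l0.
have hb x : 0 <= expR (l * Num.min x N) <= expR (l * N).
  by rewrite expR_ge0 ler_expR; apply: ler_wpM2l; rewrite // ge_min lexx orbT.
have [_ fin] := E_bounded hS hphi hZ hb.
rewrite -lee_fin fineK// hP; last exact: (H_lip hS hphi hZ).
apply: ge_ereal_sup => _ [P PP <-].
have If := integrable_explog mZ (hM _ PP).
have [K K0 hK] := le_explog_abs a1.
have IZ : P.-integrable setT (EFin \o Z).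
  apply: (le_integrable _ _ _ (integrableZl measurableT K If)) => //.
    exact/measurable_EFinP.
  move=> w _ /=; rewrite lee_fin normrM (ger0_norm K0).
  by rewrite [X in _ * X]ger0_norm ?expR_ge0.
have I1 : P.-integrable setT (EFin \o cst 1).
  exact: finite_measure_integrable_cst.
have IlZ := integrableZl measurableT l IZ.
have Icf := integrableZl measurableT (C * l ^+ 2) If.
have I2 := integrableD measurableT I1 IlZ.
have I3 := integrableD measurableT I2 Icf.
apply: (@le_trans _ _ (\int[P]_w (1%:E + l%:E * (Z w)%:E +
    (C * l ^+ 2)%:E * (explog a `|Z w|)%:E))%E).
  apply: ge0_le_integral => //.
  - apply/measurable_EFinP; exact: measurableH (H_lip hS hphi hZ).
  - exact: measurable_int I3.
  - by move=> w _; rewrite /= -!EFinM -!EFinD lee_fin hC.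
rewrite integralD// integralD// !integralZl//.
have -> : (\int[P]_w 1%:E = 1%:E :> \bar R)%E.
  rewrite integral_cst; last exact: measurableT.
  rewrite mul1e. exact: probability_setT.
rewrite -addeA.
rewrite [leRHS]EFinD leeD2l// -[leRHS]add0e leeD//.
  (* The integral of [Z] under [P] is at most [E Z = 0], and the tilt is nonnegative. *)
  rewrite mule_ge0_le0 ?lee_fin//.
  rewrite -EZ hP//; apply: ereal_sup_ubound; by exists P.
rewrite (_ : C * M * l ^+ 2 = C * l ^+ 2 * M); last by rewrite mulrAC.
rewrite [leRHS]EFinM; apply: lee_wpmul2l; last exact: hM.
by rewrite lee_fin mulr_ge0 ?sqr_ge0.
Qed.

Lemma lip_scale (s : R) (phi : R -> R) : lip phi -> lip (fun x => phi (s * x)).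
Proof.
case=> L L0 h; exists (L * `|s|) => [|x y]; first by rewrite mulr_ge0.
by rewrite (le_trans (h _ _))// -mulrBr normrM mulrA.
Qed.

Lemma lip_id : lip (@id R).
Proof. by exists 1 => // x y; rewrite mul1r. Qed.

(** A Lipschitz substitute for an indicator: 0 for |x| <= s and 1 for |x| >= t. Clamping to [0, 1]
    does not increase distances. *)
Lemma lip_ramp (s t : R) : s < t ->
  lip (fun x : R => Num.min 1 (Num.max 0 ((`|x| - s) / (t - s)))).
Proof.
move=> st; exists (t - s)^-1 => [|x y]; first by rewrite invr_ge0 subr_ge0 ltW.
have c0 : 0 <= (t - s)^-1 by rewrite invr_ge0 subr_ge0 ltW.
have h : `|(`|x| - s) / (t - s) - (`|y| - s) / (t - s)| <= (t - s)^-1 * `|x - y|.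
  rewrite -mulrBl normrM mulrC (ger0_norm c0) ler_wpM2l//.
  rewrite (_ : _ - _ = `|x| - `|y|); last by ring.
  exact: ler_dist_dist.
apply: le_trans h.
move: (_ / _) (_ / _) => p q.
rewrite ler_norml; apply/andP.
have := ler_norm (p - q); have := ler_norm (q - p); rewrite (distrC q).
by have [?|?] := leP 0 p; have [?|?] := leP 0 q; split;
   rewrite ?(@min_r _ _ 1 0)//;
   try have [?|?] := leP 1 p; try have [?|?] := leP 1 q; lra.
Qed.

(** Equality in distribution is tested on Lipschitz functions only, so the tails are compared
    through a ramp, at the price of the gap [s < t]. *)
Lemma capV_tail_ident (X Y : T -> R) (s t : R) : s < t ->
  H X -> H Y -> ident_distr E Y X ->
  (capV Pfam [set w | (t < `|Y w|)%R] <= capV Pfam [set w | (s < `|X w|)%R])%E.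
Proof.
move=> st hX hY hid.
have mabs Z : H Z -> measurable_fun setT (fun w => `|Z w|).
  by move=> hZ; apply: measurableT_comp => //; exact: measurableH.
have hh := lip_ramp st.
pose h (x : R) := Num.min 1 (Num.max 0 ((`|x| - s) / (t - s))).
have hB x : 0 <= h x <= 1 by rewrite /h ge_min le_min le_max !lexx ler01.
have ts : 0 < t - s by rewrite subr_gt0.
apply: (@le_trans _ _ (E (fun w => h (Y w)))).
  apply: (capV_le_E hS hP).
  - by apply: measurable_gt; exact: mabs.
  - exact: (H_lip hS hh hY).
  - by move=> w; case/andP : (hB (Y w)).
  move=> w /= tY; rewrite /h le_min lexx /= le_max; apply/orP; right.
  by rewrite ler_pdivlMr// mul1r lerD2r ltW.
rewrite (E_ident hS hh hX hY hid hB).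
apply: (E_le_capV hS hP).
- by apply: measurable_gt; exact: mabs.
- exact: (H_lip hS hh hX).
move=> w; case/andP : (hB (X w)) => -> h1 /=.
rewrite indicE; case: (boolP (w \in _)) => //; rewrite notin_setE/= => /negP.
rewrite -leNgt => Xs; rewrite /h ge_min ge_max lexx /=; apply/orP; right.
by rewrite pmulr_lle0 ?invr_gt0// subr_le0.
Qed.

(** Exponential Markov inequality, factored by [E_prod_indep]. The factor [s], later 1 or -1, sits
    in the test function, so that both signs use the independence of the same [Xs]. *)
Lemma capV_trunc_sum_le (X : T -> R) (Xs : nat -> T -> R) (s l N t : R) n :
  H X -> (forall k, H (Xs k)) -> indep_seq H E Xs ->
  (forall k, ident_distr E (Xs k) X) -> 0 <= l ->
  (capV Pfam [set w | (t < \sum_(k < n) Num.min (s * Xs k w) N)%R] <=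
  (expR (- (l * t)) *
   fine (E (fun w => expR (l * Num.min (s * X w) N))) ^+ n)%:E)%E.
Proof.
move=> hX hXs hind hid l0.
have hphi : lip (fun x => expR (l * Num.min (s * x) N)).
  exact: (lip_scale s (lip_expR_trunc N l0)).
have hb x : 0 <= expR (l * Num.min (s * x) N) <= expR (l * N).
  by rewrite expR_ge0 ler_expR; apply: ler_wpM2l; rewrite // ge_min lexx orbT.
have HP : H (fun w => \prod_(k < n) expR (l * Num.min (s * Xs k w) N)).
  exact: (H_locLip hS (locLip_prod n hphi hb) (fun k : 'I_n => hXs k)).
rewrite EFinM -(E_prod_indep hS n hphi hX hXs hind hid hb).
rewrite -(E_scale hS HP) ?expR_ge0//.
apply: (capV_le_E hS hP).
- apply: measurable_gt; apply: measurable_sum => k.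
  apply: measurable_minr => //; apply: measurable_funM => //.
  exact: measurableH.
- exact: (H_lip hS (lip_scale _ lip_id) HP).
- by move=> w; rewrite mulr_ge0 ?expR_ge0// prodr_ge0// => k _; exact: expR_ge0.
move=> w /= tS; rewrite -expR_sum -mulr_sumr -expRD -expR0 ler_expR.
by rewrite addrC -mulrBr mulr_ge0// subr_ge0 ltW.
Qed.

End TailBounds.

(** * The series *)

(** Keeps (1 + C M l^2)^n bounded: [n * l ^+ 2] is at most (log N)^(2a) / N. *)
Lemma tilt_sqr_le {R : realType} (theta a N n : R) : 0 < a -> 0 < theta < 1 ->
  1 <= N -> 0 <= n <= N -> n * tilt theta a N ^+ 2 <= (a * 2) `^ (a * 2).
Proof.
move=> a0 /andP[t0 t1] N1 /andP[n0 nN].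
have N0 : 0 < N by rewrite (lt_le_trans ltr01).
have L0 : 0 <= logp N `^ a / N by rewrite divr_ge0 ?powR_ge0 ?ltW.
apply: (@le_trans _ _ (N * (logp N `^ a / N) ^+ 2)).
  apply: ler_pM => //; first exact: sqr_ge0.
  rewrite ler_sqr ?nnegrE ?tilt_ge0 ?(ltW t0) ?(ltW N0)//.
  by rewrite /tilt ler_piMl ?(ltW t1).
have -> : N * (logp N `^ a / N) ^+ 2 = (logp N `^ a) ^+ 2 / N.
  by field; rewrite gt_eqF.
rewrite ler_pdivrMr// -powR_mulrn ?powR_ge0// -powRrM.
by rewrite logp_powR_le// mulr_gt0.
Qed.

Section Series.
Context {R : realType} {d : measure_display} {T : measurableType d}.
Variables (H : set (T -> R)) (E : (T -> R) -> \bar R).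
Variable Pfam : set (probability T R).
Hypotheses (hS : sublinear_expectation_space H E) (hP : represents Pfam H E).

Let measurableH Y : H Y -> measurable_fun setT Y.
Proof. exact: hS.1. Qed.

Lemma capV_sum_tail (X : T -> R) (Xs : nat -> T -> R) (a M eps : R) :
  H X -> (forall k, H (Xs k)) -> indep_seq H E Xs ->
  (forall k, ident_distr E (Xs k) X) ->
  E X = 0%E -> E (fun w => - X w) = 0%E -> 1 < a -> 0 <= M ->
  (forall P, Pfam P -> (\int[P]_w (explog a `|X w|)%:E <= M%:E)%E) ->
  1 < eps ->
  exists D delta : R, [/\ 0 <= D, 0 < delta & forall n : nat, (0 < n)%N ->
    (capV Pfam [set w | (n%:R * eps < `|\sum_(k < n) Xs k w|)%R] <=
     n%:R%:E * capV Pfam [set w | (n%:R < `|X w|)%R] +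
     (D * expR (- ((1 + delta) * logp (n%:R : R) `^ a)))%:E)%E].
Proof.
move=> hX hXs hind hid EX ENX a1 M0 hM eps1.
have a0 : 0 < a by rewrite (lt_trans ltr01).
(* Of the four factors [b] of [eps], one pays for [theta], one for [N], and the other two leave
   [1 + delta = b ^+ 2]. *)
have [b b1 b4] : exists2 b : R, 1 < b & eps = b ^+ 4.
  have sq1 (x : R) : 1 < x -> 1 < Num.sqrt x.
    by move=> x1; rewrite -[1]sqrtr1 ltr_sqrt// (lt_trans ltr01).
  exists (Num.sqrt (Num.sqrt eps)); first exact: (sq1 _ (sq1 _ eps1)).
  rewrite (_ : 4 = 2 * 2)%N// exprM !sqr_sqrtr ?sqrtr_ge0//.
  by rewrite (le_trans ler01) ?ltW.
have b0 : 0 < b by rewrite (lt_trans ltr01).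
have t01 : 0 < b^-1 < 1 by rewrite invr_gt0 b0 invf_lt1.
have [C C0 hC] := E_expR_trunc_le hS hP a1 t01.
(* With [theta = 1 / b] and [N = b n], [tilt * (n eps) = b^2 (log N)^a]. *)
exists (2 * expR (C * M * (a * 2) `^ (a * 2))), (b ^+ 2 - 1); split.
- by rewrite mulr_ge0 ?expR_ge0.
- by rewrite subr_gt0 exprn_egt1.
move=> n n0; have nR0 : 0 < n%:R :> R by rewrite ltr0n.
set N := b * n%:R; set l := tilt b^-1 a N.
have nN : n%:R < N by rewrite ltr_pMl.
have N1 : 1 <= N by rewrite (le_trans _ (ltW nN))// ler1n.
have N0 : 0 < N by rewrite (lt_le_trans ltr01).
have l0 : 0 <= l by rewrite tilt_ge0 ?(ltW N0)// invr_ge0 ltW.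
pose A s := [set w | (n%:R * eps < \sum_(k < n) Num.min (s * Xs k w) N)%R].
pose Bd := expR (C * M * (a * 2) `^ (a * 2)) *
  expR (- ((1 + (b ^+ 2 - 1)) * logp (n%:R : R) `^ a)).
have mXs k : measurable_fun setT (Xs k) by exact: measurableH.
have mA s : measurable (A s).
  apply: measurable_gt; apply: measurable_sum => k.
  by apply: measurable_minr => //; apply: measurable_funM.
have capA s : `|s| = 1 -> E (fun w => s * X w) = 0%E ->
    (capV Pfam (A s) <= Bd%:E)%E.
  move=> s1 EsX; apply: (le_trans (capV_trunc_sum_le hS hP _ _ _ _ hX _ _ _ l0)) => //.
  have hsX : H (fun w => s * X w) := H_lip hS (lip_scale s lip_id) hX.
  have hM' P : Pfam P -> (\int[P]_w (explog a `|s * X w|)%:E <= M%:E)%E.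
    by move=> PP; under eq_integral do rewrite normrM s1 mul1r; exact: hM.
  have hr := hC (fun w => s * X w) M hsX EsX hM' N N1; rewrite -/l in hr.
  have r0 : 0 <= fine (E (fun w => expR (l * Num.min (s * X w) N))).
    have hb x : 0 <= expR (l * Num.min x N) <= expR (l * N).
      rewrite expR_ge0 ler_expR; apply: ler_wpM2l; rewrite // ge_min lexx orbT//.
    have [/andP[? _] _] := E_bounded hS (lip_expR_trunc N l0) hsX hb.
    exact: fine_ge0.
  rewrite lee_fin /Bd mulrC ler_pM ?expR_ge0 ?exprn_ge0//.
    (* Uses 1 + t <= e^t, after which [tilt_sqr_le] bounds the exponent [n * (C * M * l ^+ 2)]. *)
    apply: (@le_trans _ _ (expR (C * M * l ^+ 2) ^+ n)).
      by rewrite lerXn2r ?nnegrE ?expR_ge0// (le_trans hr)// expR_ge1Dx.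
    rewrite -expRM_natl ler_expR mulrCA ler_wpM2l ?mulr_ge0//.
    by apply: tilt_sqr_le; rewrite ?ler0n ?(ltW nN).
  rewrite ler_expR lerN2.
  have -> : l * (n%:R * eps) = b ^+ 2 * logp N `^ a.
    by rewrite /l /tilt /N b4; field; rewrite !gt_eqF.
  rewrite addrC subrK ler_wpM2l ?exprn_ge0 ?(ltW b0)//.
  by rewrite ge0_ler_powR ?(ltW a0) ?nnegrE ?logp_ge0// le_logp// ltW.
have -> : 2 * expR (C * M * (a * 2) `^ (a * 2)) *
    expR (- ((1 + (b ^+ 2 - 1)) * logp n%:R `^ a)) = Bd + Bd.
  by rewrite /Bd; ring.
have c1 : (capV Pfam (A 1%R) <= Bd%:E)%E.
  by apply: capA; rewrite ?normr1//; under eq_fun do rewrite mul1r.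
have cN1 : (capV Pfam (A (-1)%R) <= Bd%:E)%E.
  by apply: capA; rewrite ?normrN1//; under eq_fun do rewrite mulN1r.
apply: le_trans _ (leeD2l _ (leeD c1 cN1)).
apply: (capV_bigsetU_le (J := fun k => [set w | (N < `|Xs k w|)%R])) => //.
- by move=> k; apply: measurable_gt; apply: measurableT_comp.
- by apply: measurable_gt; apply: measurableT_comp => //; exact: measurable_sum.
- by move=> k; exact: (capV_tail_ident hS hP nN hX (hXs k) (hid k)).
(* Without a jump no truncation is active, and the sign of the sum decides between [A 1] and
   [A (-1)]. *)
move=> w /= hw.
have [[k kn hk]|hk] := pselect (exists2 k, (k < n)%N & N < `|Xs k w|).
  by left; rewrite -(bigcup_mkord n (fun k => [set w | N < `|Xs k w|])); exists k.
have {}hk k : (k < n)%N -> `|Xs k w| <= N.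
  by move=> kn; rewrite leNgt; apply/negP => h; apply: hk; exists k.
have hmin s (k : 'I_n) : `|s| = 1 -> Num.min (s * Xs k w) N = s * Xs k w.
  move=> s1; apply: min_l; rewrite (le_trans (ler_norm _))//.
  by rewrite normrM s1 mul1r hk.
right; rewrite /A /=.
have [S0|S0] := ler0P (\sum_(k < n) Xs k w).
  right => /=; rewrite (eq_bigr (fun k : 'I_n => -1 * Xs k w)).
    by rewrite -mulr_sumr mulN1r -(ler0_norm S0).
  by move=> k _; rewrite hmin ?normrN1.
left => /=; rewrite (eq_bigr (fun k : 'I_n => 1 * Xs k w)).
  by rewrite -mulr_sumr mul1r -(gtr0_norm S0).
by move=> k _; rewrite hmin ?normr1.
Qed.

Local Open Scope ereal_scope.

(** For [x] in the cell from [explog a i] to [explog a i.+1], the event [i.+1 < |X|] forces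
    [x < explog a |X|]; the cells are disjoint. *)
Lemma explog_series_le_choquet (X : T -> R) (a : R) : Pfam !=set0 ->
  measurable_fun setT X -> (0 < a)%R ->
  \sum_(i <oo) ((explog a (i.+1%:R : R) - explog a i%:R)%:E *
                capV Pfam [set w | (i.+1%:R < `|X w|)%R])
  <= choquet Pfam (fun w => explog a `|X w|).
Proof.
move=> P0 mX a0.
have mf : measurable_fun setT (fun w => explog a `|X w|) by exact: measurable_explog.
have mV := measurable_capV_tail P0 mf.
rewrite choquet_ge0//; last by move=> w; exact: expR_ge0.
(* The cell [F 0] is empty, since [explog] equals 1 at both 0 and 1. *)
pose F (i : nat) : set R := `[explog a i%:R, explog a i.+1%:R[%classic.
pose V x := capV Pfam [set w | (x < explog a `|X w|)%R].
have mono (i j : nat) : (i <= j)%N -> (explog a (i%:R : R) <= explog a j%:R)%R.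
  by move=> ij; rewrite le_explog ?ler_nat// ltW.
have inF i x : F i x -> (explog a (i%:R : R) <= x < explog a i.+1%:R)%R.
  by rewrite /F /mkset in_itv.
have mF i : measurable (F i) by exact: measurable_itv.
have tF : trivIset setT F.
  apply: ltn_trivIset => i j ij; apply/seteqP; split => // x [].
  move=> /inF/andP[ix xi] /inF/andP[jx xj].
  by have := lt_le_trans xi (le_trans (mono _ _ ij) jx); rewrite ltxx.
apply: (@le_trans _ _ (\sum_(i <oo) \int[lebesgue_measure]_(x in F i) V x)).
  apply: lee_nneseries => i _.
    by rewrite mule_ge0 ?capV_ge0// lee_fin subr_ge0 mono.
  rewrite (_ : (_ - _)%:E = lebesgue_measure (F i)); last first.
    rewrite /F lebesgue_measure_itv/= lte_fin; case: ifPn => //.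
    rewrite -leNgt => h; apply/eqP; rewrite eqe subr_eq0; apply/eqP/le_anti.
    by rewrite h mono.
  rewrite muleC -integral_cst; last exact: mF.
  apply: ge0_le_integral => //.
  - exact: mF.
  - by move=> x _; exact: capV_ge0.
  - exact: measurable_funTS.
  move=> x /inF/andP[_ xi]; apply: le_capV.
  - by apply: measurable_gt; apply: measurableT_comp.
  - exact: measurable_gt.
  move=> w /= iX; apply: (lt_trans xi); apply: lt_explog => //.
  by rewrite ler1n.
rewrite -ge0_integral_bigcup//; last 2 first.
  - exact: measurable_funTS.
  - by move=> x _; exact: capV_ge0.
apply: ge0_subset_integral => //.
- by apply: bigcup_measurable => k _; exact: mF.
- exact: measurable_funTS.
- by move=> x _; exact: capV_ge0.
move=> x [i _ /inF/andP[ix _]]; rewrite /mkset in_itv/= andbT.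
exact: le_trans (expR_ge0 _) ix.
Qed.

End Series.

(** Telescoping: 1/x^2 <= 2 (1/x - 1/(x+1)) for x >= 1. *)
Lemma inverse_squares_lty {R : realType} (c : R) : 0 <= c ->
  (\sum_(i <oo) (c / i.+1%:R ^+ 2)%:E < +oo)%E.
Proof.
move=> c0; apply: (@le_lt_trans _ _ (2 * c)%:E); last exact: ltry.
apply: lime_le.
  by apply: is_cvg_nneseries => n _ _; rewrite lee_fin divr_ge0 ?sqr_ge0.
apply: nearW => n; rewrite sumEFin lee_fin.
suff h : \sum_(0 <= i < n) c / i.+1%:R ^+ 2 <= 2 * c * (1 - n.+1%:R^-1).
  by rewrite (le_trans h)// ler_piMr ?mulr_ge0.
elim: n => [|n IH]; first by rewrite big_nil invr1 subrr mulr0.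
rewrite big_nat_recr//= -lerBrDr (le_trans IH)// -subr_ge0.
have n0 : 0 < n.+1%:R :> R by rewrite ltr0n.
rewrite -[n.+2%:R]natr1; move: (n.+1%:R) n0 (ler1n R n.+1) => x x0 x1.
rewrite (_ : _ - _ = c * (x - 1) / (x ^+ 2 * (x + 1))).
  by rewrite divr_ge0 ?mulr_ge0 ?subr_ge0 ?sqr_ge0 ?addr_ge0 ?(ltW x0).
by field; rewrite !gt_eqF// addr_gt0.
Qed.

Theorem theorem3p1 (R : realType) (d : measure_display) (T : measurableType d)
  (H : set (T -> R)) (E : (T -> R) -> \bar R) (Pfam : set (probability T R))
  (hS : sublinear_expectation_space H E) (hreg : regular_sle H E)
  (hcs : countably_subadditive H E) (hP : represents Pfam H E)
  (alpha : R) (halpha : 1 < alpha)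
  (X : T -> R) (Xs : nat -> T -> R)
  (hX : H X) (hXs : forall k, H (Xs k))
  (hind : indep_seq H E Xs) (hid : forall k, ident_distr E (Xs k) X)
  (hmom : (E (fun w => expR (logp `|X w| `^ alpha))
           <= choquet Pfam (fun w => expR (logp `|X w| `^ alpha)))%E)
  (hmomfin : (choquet Pfam (fun w => expR (logp `|X w| `^ alpha)) < +oo)%E)
  (hmean : E X = 0%E) (hmean' : E (fun w => - X w) = 0%E) :
  forall eps : R, 1 < eps ->
    (\sum_(1 <= n <oo)
       ((expR (logp (n%:R : R) `^ alpha) * logp (n%:R : R) `^ (alpha - 1)
          / (n%:R ^+ 2))%:E
        * capV Pfam [set w | (n%:R * eps < `|\sum_(k < n) Xs k w|)%R]) < +oo)%E.
Proof.
move=> eps eps1.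
have a0 : 0 < alpha by rewrite (lt_trans ltr01).
have P0 : Pfam !=set0 := Pfam_neq0 hS hP hX.
have mX : measurable_fun setT X := hS.1 _ hX.
have choquet_fin : choquet Pfam (fun w => explog alpha `|X w|) \is a fin_num.
  rewrite ge0_fin_numE//; case: P0 => P PP.
  apply: le_trans (integral_le_choquet PP (measurable_explog alpha mX) _).
    by apply: integral_ge0 => w _; rewrite lee_fin expR_ge0.
  by move=> w; exact: expR_ge0.
pose M := fine (choquet Pfam (fun w => explog alpha `|X w|)).
have hM P : Pfam P -> (\int[P]_w (explog alpha `|X w|)%:E <= M%:E)%E.
  move=> PP; rewrite fineK//.
  apply: integral_le_choquet => //; first exact: measurable_explog.
  by move=> w; exact: expR_ge0.
have M0 : 0 <= M.
  case: P0 => P PP; rewrite -lee_fin; apply: le_trans (hM P PP).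
  by apply: integral_ge0 => w _; rewrite lee_fin expR_ge0.
have [D [delta [D0 delta0 tail]]] :=
  capV_sum_tail hS hP hX hXs hind hid hmean hmean' halpha M0 hM eps1.
have [K1 K10 hK1] := @explog_increment R alpha halpha.
have [K2 K20 hK2] := powR_mul_expRN_bounded halpha delta0.
(* Up to the factor [K1], [big] bounds the jump part and [small] the truncated part of the term with
   [n = i.+1]. *)
pose big (i : nat) : \bar R := ((explog alpha (i.+1%:R : R) - explog alpha i%:R)%:E *
   capV Pfam [set w | (i.+1%:R < `|X w|)%R])%E.
pose small (i : nat) : \bar R := (D * K2 / i.+1%:R ^+ 2)%:E.
have big0 i : (0 <= big i)%E.
  rewrite mule_ge0 ?capV_ge0// lee_fin subr_ge0 le_explog ?(ltW a0)//.
  by rewrite ler_nat.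
have small0 i : (0 <= small i)%E.
  by rewrite lee_fin divr_ge0 ?mulr_ge0 ?sqr_ge0.
have w0 (n : nat) : 0 <= expR (logp (n%:R : R) `^ alpha) *
    logp (n%:R : R) `^ (alpha - 1) / (n%:R ^+ 2).
  by rewrite divr_ge0 ?mulr_ge0 ?expR_ge0 ?powR_ge0 ?sqr_ge0.
rewrite -(nneseries_addn 1); last first.
  by move=> i; rewrite mule_ge0 ?lee_fin ?capV_ge0.
apply: (@le_lt_trans _ _ (\sum_(i <oo) (K1%:E * big i + small i))%E); last first.
  rewrite nneseriesD//; last by move=> i _ _; rewrite mule_ge0 ?lee_fin.
  rewrite nneseriesZl//.
  apply: lte_add_pinfty; last by apply: inverse_squares_lty; exact: mulr_ge0.
  rewrite lte_mul_pinfty ?lee_fin//.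
  exact: le_lt_trans (explog_series_le_choquet P0 mX a0) hmomfin.
apply: lee_nneseries => [i _ _|i _].
  by rewrite mule_ge0 ?lee_fin ?capV_ge0.
rewrite addn1; set n := i.+1.
have nR0 : 0 < n%:R :> R by rewrite ltr0n.
set L := logp (n%:R : R).
have L0 : 0 <= L := logp_ge0 _.
set c := _ / _; have c0 : 0 <= c := w0 n.
apply: (le_trans (lee_wpmul2l _ (tail n isT))); first by rewrite lee_fin.
rewrite ge0_muleDr; last 2 first.
- by rewrite mule_ge0 ?lee_fin ?capV_ge0.
- by rewrite lee_fin mulr_ge0 ?expR_ge0.
apply: leeD.
  (* The factor [n] of the jump bound turns the weight into the left side of [explog_increment]. *)
  rewrite /big !muleA -!EFinM lee_wpmul2r ?capV_ge0// lee_fin.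
  rewrite (le_trans _ (hK1 i))// -/n -/L /c /explog -/L.
  rewrite le_eqVlt; apply/orP; left; apply/eqP; field.
  by rewrite gt_eqF.
rewrite -EFinM lee_fin -/L.
(* The exponential in the weight cancels the 1 of [1 + delta]; the rest tames the power of the
   logarithm and leaves 1/n^2. *)
have -> : c * (D * expR (- ((1 + delta) * L `^ alpha))) =
    D * (L `^ (alpha - 1) * expR (- (delta * L `^ alpha))) / n%:R ^+ 2.
  have -> : - ((1 + delta) * L `^ alpha) = - (delta * L `^ alpha) - L `^ alpha.
    by ring.
  rewrite /c expRD [expR (- L `^ alpha)]expRN; field.
  by rewrite gt_eqF//= gt_eqF// expR_gt0.
by rewrite ler_wpM2r ?invr_ge0 ?sqr_ge0// ler_wpM2l// hK2.
Qed.
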